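(* Let $1\le p\le\infty$ and let $T=M_wEM_u$ be a bounded weighted conditional expectation operator on $L^p(\mathcal{F})$. Then $\mathcal{N}(T^2)=\mathcal{N}(T^{n+2})$ for all $n\in\mathbb{N}$. Moreover, $\alpha(T)\le 2$.
   Context: $(X,\mathcal{F},\mu)$ is a complete $\sigma$-finite measure space and $\mathcal{A}\subseteq\mathcal{F}$ is a $\sigma$-subalgebra such that $(X,\mathcal{A},\mu|_{\mathcal{A}})$ is also $\sigma$-finite. Statements about sets and functions hold up to sets of measure zero. $L^0(\mathcal{F})$ is the set of (classes of) $\mathcal{F}$-measurable complex-valued functions, and $L^p(\mathcal{F})=L^p(X,\mathcal{F},\mu)$. $E=E^{\mathcal{A}}$ is the conditional expectation with respect to $\mathcal{A}$: $E(f)$ is the unique $\mathcal{A}$-measurable function with $\int_A E(f)\,d\mu=\int_A f\,d\mu$ for all $A\in\mathcal{A}$, defined for $f\ge 0$ and for $f\in L^p(\mathcal{F})$, and extended to conditionable functions (those with $E(|f|)<\infty$ a.e.). For $u,w\in L^0(\mathcal{F})$ such that $uf$ is conditionable and $wE(uf)\in L^p(\mathcal{F})$ for all $f\in L^p(\mathcal{F})$, the weighted conditional expectation operator $T=M_wEM_u$ on $L^p(\mathcal{F})$ is $Tf=wE(uf)$; it is assumed to be bounded. $\mathcal{N}(\cdot)$ denotes the null space. The ascent $\alpha(T)$ is the smallest non-negative integer $k$ with $\mathcal{N}(T^k)=\mathcal{N}(T^{k+1})$ (where $T^0=I$), and $\alpha(T)=\infty$ if there is no such $k$. *)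

(* Defs.v *)
From HB Require Import structures.
From mathcomp Require Import all_boot all_order all_algebra.
From mathcomp Require Import complex.
From mathcomp Require Import all_classical all_reals all_analysis.
From mathcomp Require Import measurable_realfun.

Set Implicit Arguments.
Unset Strict Implicit.
Unset Printing Implicit Defensive.

Import Order.TTheory GRing.Theory Num.Theory.
Import numFieldNormedType.Exports.

Local Open Scope classical_set_scope.
Local Open Scope ring_scope.
Local Open Scope complex_scope.
Local Open Scope ereal_scope.

(** Functions are taken pointwise and identified modulo [mu]-a.e. equality:
    no quotient is formed, but equations between functions are always stated
    with [%[ae mu]]. *)

Section complex_functions.
Context {d : measure_display} {X : measurableType d} {R : realType}.
Implicit Types (mu : {measure set X -> \bar R}) (p : \bar R) (f : X -> R[i]).

(** Membership in L^0(F), F being the sigma-algebra of [X]. *)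
Definition cmeasurable f :=
  measurable_fun setT (fun x => complex.Re (f x)) /\
  measurable_fun setT (fun x => complex.Im (f x)).

Definition cabs f : X -> \bar R := fun x => (Normc.normc (f x))%:E.

Definition Lp_norm mu p f : \bar R := 'N[mu]_p[cabs f].

Definition Lp mu p : set (X -> R[i]) :=
  [set f | cmeasurable f /\ Lp_norm mu p f < +oo].

(** An operator is represented by a map on all functions, of which only the
    values on [Lp mu p] matter. *)
Definition null_space mu p (S : (X -> R[i]) -> (X -> R[i])) :
    set (X -> R[i]) :=
  [set f | Lp mu p f /\ S f = cst 0%R %[ae mu]].

Definition bounded_on_Lp mu p (S : (X -> R[i]) -> (X -> R[i])) :=
  exists M : R, forall f, Lp mu p f -> Lp_norm mu p (S f) <= M%:E * Lp_norm mu p f.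

Definition ascent mu p (S : (X -> R[i]) -> (X -> R[i])) : \bar R :=
  if pselect (exists k : nat,
      `[< null_space mu p (iter k S) = null_space mu p (iter k.+1 S) >]) is left h
  then (ex_minn h)%:R%:E
  else +oo.

End complex_functions.

Section conditional_expectation.
Context {d : measure_display} {X : measurableType d} {R : realType}.
Variables (A : set (set X)) (mu : {measure set X -> \bar R}).

Definition sub_sigma_finite :=
  [/\ sigma_algebra setT A,
      A `<=` (@measurable d X) &
      sigma_finite [set: g_sigma_algebraType A] mu].

Definition is_condexp (f g : X -> \bar R) :=
  [/\ measurable_fun setT (g : g_sigma_algebraType A -> \bar R),
      (forall x, 0 <= g x) &
      forall B, A B -> \int[mu]_(x in B) g x = \int[mu]_(x in B) f x].

(** A version of E(f) for [f] measurable with values in [0, +oo]; it is unique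
    up to a null set. *)
Definition condexp_ge0 (f : X -> \bar R) : X -> \bar R :=
  xget (cst 0) [set g | is_condexp f g].

Definition conditionable (f : X -> R[i]) :=
  cmeasurable f /\ \forall x \ae mu, condexp_ge0 (cabs f) x < +oo.

Definition condexp_real (f : X -> R) : X -> R := fun x =>
  (fine (condexp_ge0 ((EFin \o f)^\+)%E x) -
   fine (condexp_ge0 ((EFin \o f)^\-)%E x))%R.

(** Meaningful only for [conditionable] functions: the four expectations below
    are then finite a.e. *)
Definition condexp (f : X -> R[i]) : X -> R[i] := fun x =>
  condexp_real (fun y => complex.Re (f y)) x +i*
  condexp_real (fun y => complex.Im (f y)) x.

Definition wce (w u : X -> R[i]) (f : X -> R[i]) : X -> R[i] := fun x =>
  (w x * condexp (fun y => u y * f y) x)%R.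

End conditional_expectation.

(* Main.v *)
Require Import Defs.
From HB Require Import structures.
From mathcomp Require Import all_boot all_order all_algebra.
From mathcomp Require Import complex.
From mathcomp Require Import all_classical all_reals all_analysis.
From mathcomp Require Import measurable_realfun.
From mathcomp Require Import ring.

(** Write [E] for the conditional expectation and [T f = w E(u f)]. Everything
    rests on one identity. Put [g = E(u f)], [h = E(u (T f))] and
    [k = E(u (T (T f)))], so that [T f = w g], [T (T f) = w h] and
    [T (T (T f)) = w k]. Since [g] and [h] are A-measurable they can be moved in
    and out of [E], and a.e.

      [h * h = h * E(u w g) = E(u w g h) = g * E(u w h) = g * k].

    If [w k = 0] a.e., then at almost every point [w = 0] or [k = 0]; in the
    second case [h * h = 0], so [w h = 0] either way. Hence the kernel of the
    third power of [T] is contained in that of the second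
    ([wce_cube_ae0]). The opposite inclusion only says that [T] maps a.e. null
    functions to a.e. null functions ([wce_ae0]). Applied to the iterates of
    [T] at [f], which stay in L^p, this gives the equality of all null spaces
    from exponent 2 on, and therefore the bound on the ascent. The
    product [u w] alone may fail to be conditionable, which is why [E(u w)] does
    not appear: the functions whose expectations occur, [u f], [u (T f)] and
    [u (T (T f))], are [u] times elements of L^p.

    The identity needs three facts about [E], developed first for nonnegative
    functions: existence ([condexp_exists]), by the Radon-Nikodym theorem on
    countably many pieces; uniqueness ([condexp_le]), by comparing integrals on
    A-measurable sets of finite measure; and pulling out A-measurable factors
    ([integral_mul_eq]), by approximation with simple functions. They pass to
    real functions through representations as differences of nonnegative
    functions with finite expectations, which are stable under sums and
    products without any integrability assumption, and then to complex
    functions by real and imaginary parts. *)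

Set Implicit Arguments.
Unset Strict Implicit.
Unset Printing Implicit Defensive.

Import Order.TTheory GRing.Theory Num.Theory.
Import numFieldNormedType.Exports.

Local Open Scope classical_set_scope.
Local Open Scope ring_scope.
Local Open Scope complex_scope.
Local Open Scope ereal_scope.

Import HBNNSimple.

(** * The sub-sigma-algebra as a measurable space *)

Section sub_sigma_algebra.
Context d (X : measurableType d) (R : realType).
Variables (mu : {measure set X -> \bar R}) (A : set (set X)).
Hypothesis A_sub : sub_sigma_finite A mu.

Local Notation S := (g_sigma_algebraType A).
Local Notation "f \is-A-measurable" := (measurable_fun [set: S] (f : S -> _))
  (at level 70).

Lemma sub_measurableE : @measurable _ S = A.
Proof. by case: A_sub => sA _ _; exact: measurable_g_measurableTypeE. Qed.

Lemma sub_measurableP (B : set X) : @measurable _ S B <-> A B.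
Proof. by rewrite sub_measurableE. Qed.

Lemma sub_measurable_set (B : set X) : A B -> measurable B.
Proof. by case: A_sub => _ + _; exact. Qed.

Lemma sub_measurable_fun d' (Y : measurableType d') (f : X -> Y) :
  f \is-A-measurable -> measurable_fun [set: X] f.
Proof.
move=> mf _ B mB; apply/sub_measurable_set/sub_measurableP.
exact: mf.
Qed.

Lemma measurable_id_sub : measurable_fun [set: X] (idfun : X -> S).
Proof. by apply: sub_measurable_fun; exact: measurable_id. Qed.

(** Taking the proof that A is a sub-sigma-algebra as an argument lets the measure
    structure below be inferred from the term alone. *)
Definition restrict_measure of sub_sigma_finite A mu :=
  fun m : {measure set X -> \bar R} => (m : set S -> \bar R).

Section restrict_measure_is_measure.
Variables (H : sub_sigma_finite A mu) (m : {measure set X -> \bar R}).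
Local Notation mA := (restrict_measure H m).

Let mA0 : mA set0 = 0. Proof. exact: measure0. Qed.

Let mA_ge0 B : 0 <= mA B. Proof. exact: measure_ge0. Qed.

Let mA_sigma_additive : semi_sigma_additive mA.
Proof.
move=> F mF tF mUF; apply: measure_semi_sigma_additive => //.
- by move=> i; apply/sub_measurable_set/sub_measurableP; exact: mF.
- by apply/sub_measurable_set/sub_measurableP.
Qed.

HB.instance Definition _ :=
  isMeasure.Build _ S R mA mA0 mA_ge0 mA_sigma_additive.

End restrict_measure_is_measure.

Lemma sub_exhaustion : exists F : nat -> set X,
  [/\ nondecreasing_seq F, forall i, A (F i), forall i, mu (F i) < +oo
    & \bigcup_i F i = setT].
Proof.
case: A_sub => sA AX [F FT mF].
have /sigma_finiteP[G [GT ndG mG]] :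
    sigma_finite [set: S] (restrict_measure A_sub mu) by exists F.
exists G; split => // i; by have [/sub_measurableP AG fG] := mG i.
Qed.

(** The restricted measure is the image of [mu] under the identity map from [X]
    to the coarser measurable space. *)
Lemma ge0_integral_sub (g : X -> \bar R) B :
  g \is-A-measurable -> (forall x, 0 <= g x) -> A B ->
  \int[restrict_measure A_sub mu]_(x in B) g x = \int[mu]_(x in B) g x.
Proof.
move=> mg g0 AB; have mB : @measurable _ S B by exact/sub_measurableP.
rewrite (_ : restrict_measure A_sub mu = pushforward mu (idfun : X -> S))//.
rewrite (ge0_integral_pushforward measurable_id_sub)//.
exact: measurable_funTS.
Qed.

(** * Existence, comparison and pull-out for nonnegative functions *)

(** The set function [B |-> \int_B f] is a finite measure on A, dominated by the
    restriction of [mu]; its Radon-Nikodym density is the expectation. *)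
Lemma condexp_exists_integrable (f : X -> \bar R) : measurable_fun setT f ->
  (forall x, 0 <= f x) -> \int[mu]_x f x < +oo -> exists g, is_condexp A mu f g.
Proof.
move=> mf f0 intf.
pose n (B : set X) := \int[mu]_(x in B) f x.
have n0 : n set0 = 0 by exact: integral_set0.
have nge0 B : 0 <= n B by exact: integral_ge0.
have nsig : semi_sigma_additive n by exact: semi_sigma_additive_nng_induced.
pose nmixin := isMeasure.Build _ X R n n0 nge0 nsig.
pose nM : {measure set X -> \bar R} := HB.pack n nmixin.
pose nA := restrict_measure A_sub nM; pose mA := restrict_measure A_sub mu.
have nAfin : fin_num_fun nA.
  move=> B mB; rewrite ge0_fin_numE//; apply: le_lt_trans intf.
  have mB' : measurable (B : set X) by exact/sub_measurable_set/sub_measurableP.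
  exact: ge0_subset_integral.
have mAsf : sigma_finite [set: S] mA.
  have [F [_ AF Ffin FT]] := sub_exhaustion.
  by exists F => // i; split=> //; exact/sub_measurableP.
pose nfmixin := Measure_isFinite.Build _ S R nA nAfin.
pose nF : {finite_measure set S -> \bar R} := HB.pack nA nfmixin.
pose msmixin := Measure_isSigmaFinite.Build _ S R mA mAsf.
pose mS : {sigma_finite_measure set S -> \bar R} := HB.pack mA msmixin.
have nm : nF `<< mS.
  apply/null_content_dominatesP => B mB B0.
  have mB' : measurable (B : set X) by exact/sub_measurable_set/sub_measurableP.
  exact: (null_set_integral mB' (measurable_funTS mf) B0).
have [g [g0 _ ig gE]] := radon_nikodym_sigma_finite nm.
have mg := measurable_int _ ig.
exists g; split => // B AB.
by rewrite -ge0_integral_sub// -[LHS]gE//; exact/sub_measurableP.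
Qed.

(** [\int_B f] need not define a sigma-finite measure on A, so Radon-Nikodym does
    not apply to it directly. Cutting [X] into countably many pieces, each of
    finite measure and with [f] bounded on it, makes every piece of [f]
    integrable, and the expectations of the pieces are summed. The pieces are
    only measurable in the large sigma-algebra, which is harmless since they
    multiply [f] and not the sets of A tested against. *)
Lemma condexp_exists (f : X -> \bar R) : measurable_fun setT f ->
  (forall x, 0 <= f x) -> (forall x, f x < +oo) -> exists g, is_condexp A mu f g.
Proof.
move=> mf f0 ffin.
have [F [ndF AF Ffin FT]] := sub_exhaustion.
have mF i := sub_measurable_set (AF i).
pose Y n := F n `&` [set x | f x <= n%:R%:E].
have mY n : measurable (Y n).
  by apply: emeasurable_fun_infty_c => //; exact: measurable_funTS.
pose D := seqDU Y.
have mD n : measurable (D n) by exact: seqDU_measurable.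
have DY n : D n `<=` Y n by exact: subDsetl.
have DT : \bigcup_n D n = setT.
  rewrite -seqDU_bigcup_eq; apply/seteqP; split => // x _.
  have [k _ Fk] : (\bigcup_i F i) x by rewrite FT.
  have fE : (fine (f x))%:E = f x by rewrite fineK// ge0_fin_numE.
  exists (maxn k (Num.bound (fine (f x)))) => //; split => /=.
  - by move: Fk; apply/subsetPset/ndF; rewrite leq_maxl.
  - rewrite -fE lee_fin (@le_trans _ _ (Num.bound (fine (f x)))%:R)//.
      by rewrite ltW// archi_boundP// fine_ge0.
    by rewrite ler_nat leq_maxr.
have fD n : exists g, is_condexp A mu (f \_ (D n)) g.
  apply: condexp_exists_integrable.
  - by apply: (measurable_restrictT _ _).1 => //; exact: measurable_funTS.
  - by move=> x; exact: erestrict_ge0.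
  - rewrite -integral_mkcond.
    apply: (@le_lt_trans _ _ (\int[mu]_(x in D n) (cst n%:R%:E) x)).
      apply: ge0_le_integral => //; first exact: measurable_funTS.
      by move=> x /DY[].
    rewrite integral_cst// lte_mul_pinfty//.
    apply: le_lt_trans (Ffin n); apply: le_measure; rewrite ?inE//.
    by move=> x /DY[].
have [g gP] := choice fD.
have mg n : (g n) \is-A-measurable by case: (gP n).
have g0 n x : 0 <= g n x by case: (gP n).
exists (fun x => \sum_(n <oo) g n x); split.
- exact: ge0_emeasurable_sum.
- by move=> x; exact: nneseries_ge0.
- move=> B AB; have mB := sub_measurable_set AB.
  rewrite integral_nneseries//; last first.
    by move=> n; exact/measurable_funTS/sub_measurable_fun.
  transitivity (\sum_(n <oo) \int[mu]_(x in B) (f \_ (D n)) x).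
    by apply: eq_eseriesr => n _; case: (gP n) => _ _; exact.
  under eq_eseriesr do rewrite -integral_mkcondr.
  rewrite -ge0_integral_bigcup//.
  + by rewrite -setI_bigcupr DT setIT.
  + by move=> k; exact: measurableI.
  + exact: measurable_funTS.
  + by apply: trivIset_setIl; exact: trivIset_seqDU.
Qed.

(** On an A-set of finite measure where [g < f] and [g] is bounded, both
    integrals are finite and the nonnegative function [f - g] has integral at
    most 0, so that set is null. Countably many such sets cover the points
    where [f <= g] fails. Infinite values are allowed: this is what shows that
    an expectation dominated by an a.e. finite one is a.e. finite. *)
Lemma condexp_le (f g : X -> \bar R) :
  f \is-A-measurable -> (forall x, 0 <= f x) ->
  g \is-A-measurable -> (forall x, 0 <= g x) ->
  (forall B, A B -> \int[mu]_(x in B) f x <= \int[mu]_(x in B) g x) ->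
  \forall x \ae mu, f x <= g x.
Proof.
move=> mf f0 mg g0 fg.
have [F [ndF AF Ffin FT]] := sub_exhaustion.
pose N n := F n `&` ([set x | g x < f x] `&` [set x | g x <= n%:R%:E]).
have AN n : A (N n).
  apply/sub_measurableP; apply: measurableI; first exact/sub_measurableP.
  apply: measurableI.
    by rewrite -[X in measurable X]setTI; exact: measurable_lte.
  by rewrite -[X in measurable X]setTI; exact: emeasurable_fun_infty_c.
have mN n := sub_measurable_set (AN n).
have mf' B : measurable B -> measurable_fun B f.
  by move=> mB; exact/measurable_funTS/sub_measurable_fun.
have mg' B : measurable B -> measurable_fun B g.
  by move=> mB; exact/measurable_funTS/sub_measurable_fun.
have gN n x : N n x -> g x \is a fin_num.
  by move=> [_ [_ /= gn]]; rewrite ge0_fin_numE// (le_lt_trans gn)// ltry.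
have fgN n x : N n x -> 0 <= f x - g x.
  by move=> Nx; rewrite sube_ge0 ?(gN _ _ Nx)// ltW//; case: Nx => _ [].
have N0 n : mu (N n) = 0.
  have gfin : \int[mu]_(x in N n) g x < +oo.
    apply: (@le_lt_trans _ _ (\int[mu]_(x in N n) (cst n%:R%:E) x)).
      by apply: ge0_le_integral => //; [exact: mg'|move=> x [_ [_]]].
    rewrite integral_cst// lte_mul_pinfty//.
    apply: le_lt_trans (Ffin n); apply: le_measure; rewrite ?inE//.
      exact: sub_measurable_set.
    by apply: subIset; left.
  have ffin : \int[mu]_(x in N n) f x < +oo by exact: le_lt_trans (fg _ _) gfin.
  have ig : mu.-integrable (N n) g.
    apply/integrableP; split; first exact: mg'.
    by under eq_integral do rewrite gee0_abs//.
  have jf : mu.-integrable (N n) f.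
    apply/integrableP; split; first exact: mf'.
    by under eq_integral do rewrite gee0_abs//.
  have : \int[mu]_(x in N n) `|f x - g x| = 0.
    rewrite (eq_integral (f \- g)); last first.
      by move=> x; rewrite inE => Nx; rewrite gee0_abs//; exact: fgN Nx.
    rewrite integralB//; apply/eqP; rewrite eq_le; apply/andP; split.
      by rewrite sube_le0 fg.
    rewrite -integralB//; apply: integral_ge0 => x; exact: fgN.
  move/ae_eq_integral_abs => /(_ (mN n)) H.
  have {H} [M [mM M0 NM]] := H (emeasurable_funB (mf' _ (mN n)) (mg' _ (mN n))).
  apply: (subset_measure0 (mN n) mM _ M0).
  move=> x [Fx [/= gf gn]]; apply: NM => /= /(_ (conj Fx (conj gf gn))).
  by move=> fg0; move: gf; rewrite -sube_gt0 fg0 ltxx.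
suff : mu.-negligible (~` [set x | f x <= g x]) by [].
apply: (negligibleS _ (negligible_bigcup (fun n => (negligibleP mu (mN n)).2 (N0 n)))).
move=> x /= /negP; rewrite -ltNge => gf.
have : g x \is a fin_num by rewrite ge0_fin_numE// (lt_le_trans gf)// leey.
move/fineK => gE.
have [k _ Fk] : (\bigcup_i F i) x by rewrite FT.
exists (maxn k (Num.bound (fine (g x)))) => //; split; last split => //=.
- by move: Fk; apply/subsetPset/ndF; rewrite leq_maxl.
- rewrite -gE lee_fin (@le_trans _ _ (Num.bound (fine (g x)))%:R)//.
    by rewrite ltW// archi_boundP// fine_ge0.
  by rewrite ler_nat leq_maxr.
Qed.

Lemma integral_mul_nnsfun (h : {nnsfun S >-> R}) (B : set X) (f : X -> R) :
  measurable_fun setT f -> (forall x, (0 <= f x)%R) -> measurable B ->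
  \int[mu]_(x in B) (h x * f x)%:E =
  \sum_(r \in range h)
    r%:E * \int[mu]_(x in B `&` (h : X -> R) @^-1` [set r]) (f x)%:E.
Proof.
move=> mf f0 mB.
have mh (r : R) : measurable ((h : X -> R) @^-1` [set r]).
  by apply/sub_measurable_set/sub_measurableP; exact: measurable_sfunP.
have mi (r : R) : measurable_fun setT
    (\1_((h : X -> R) @^-1` [set r]) : X -> R) by exact: measurable_indic.
transitivity (\int[mu]_(x in B) (\sum_(r \in range h)
    (r * \1_((h : X -> R) @^-1` [set r]) x)%:E * (f x)%:E)).
  apply: eq_integral => x _.
  rewrite -ge0_mule_fsuml => [|y]; last exact: nnfun_muleindic_ge0.
  by rewrite fsumEFin// EFinM; congr (_%:E * _); exact: (fimfunE h x).
rewrite ge0_integral_fsum//; last 2 first.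
- move=> r; apply/measurable_EFinP; apply: measurable_funTS.
  apply: measurable_funM => //; exact: measurable_funM.
- move=> r x _; rewrite mule_ge0 ?lee_fin ?f0//.
  by rewrite -lee_fin EFinM; exact: nnfun_muleindic_ge0.
apply: eq_fsbigr => r rh.
transitivity (\int[mu]_(x in B) (r%:E * ((EFin \o f) \_ ((h : X -> R) @^-1` [set r])) x)).
  apply: eq_integral => x _; rewrite EFinM -muleA; congr (_ * _).
  by rewrite epatch_indic muleC.
rewrite ge0_integralZl//.
- by rewrite integral_mkcondr.
- apply: measurable_funTS; apply: (measurable_restrictT _ _).1 => //.
  by apply/measurable_EFinP; exact: measurable_funTS.
- by move=> x _; rewrite erestrict_ge0// => y _; rewrite lee_fin.
- by move: rh; rewrite inE => -[t _ <-]; rewrite lee_fin.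
Qed.

(** Equality of the integrals over A-sets is the case of indicator functions [a];
    it extends to simple functions by linearity and to all A-measurable
    nonnegative [a] by monotone convergence. *)
Lemma integral_mul_eq (a f g : X -> R) :
  a \is-A-measurable -> (forall x, (0 <= a x)%R) ->
  measurable_fun setT f -> (forall x, (0 <= f x)%R) ->
  measurable_fun setT g -> (forall x, (0 <= g x)%R) ->
  (forall B, A B -> \int[mu]_(x in B) (f x)%:E = \int[mu]_(x in B) (g x)%:E) ->
  forall B, A B ->
    \int[mu]_(x in B) (a x * f x)%:E = \int[mu]_(x in B) (a x * g x)%:E.
Proof.
move=> ma a0 mf f0 mg g0 fg B AB.
have mB := sub_measurable_set AB.
have mea : measurable_fun [set: S] (EFin \o a : S -> \bar R).
  exact/measurable_EFinP.
pose h := nnsfun_approx measurableT mea.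
have limE (k : X -> R) : measurable_fun setT k -> (forall x, (0 <= k x)%R) ->
    \int[mu]_(x in B) (h n x * k x)%:E @[n --> \oo] -->
    \int[mu]_(x in B) (a x * k x)%:E.
  move=> mk k0.
  rewrite (_ : \int[mu]_(x in B) (a x * k x)%:E =
               \int[mu]_(x in B) limn (fun n => (h n x * k x)%:E)).
    apply: cvg_monotone_convergence => //.
    - move=> n; apply/measurable_EFinP/measurable_funTS/measurable_funM => //.
      exact/sub_measurable_fun.
    - by move=> n x _; rewrite lee_fin mulr_ge0.
    - move=> x _ n m nm; rewrite lee_fin ler_wpM2r//.
      by have /lefP := nd_nnsfun_approx measurableT mea nm; exact.
  apply: eq_integral => x _; apply/esym/cvg_lim => //.
  rewrite EFinM; under eq_fun do rewrite EFinM.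
  apply: cvgeZr => //; apply: (cvg_nnsfun_approx measurableT mea) => //.
  by move=> y _; rewrite lee_fin.
have := limE f mf f0.
rewrite (_ : (fun n => _) = (fun n => \int[mu]_(x in B) (h n x * g x)%:E)).
  by move=> fl; apply: (cvg_unique _ fl (limE g mg g0)).
apply/funext => n; rewrite !integral_mul_nnsfun//.
apply: eq_fsbigr => r _; congr (_ * _); apply: fg.
apply/sub_measurableP; apply: measurableI; first exact/sub_measurableP.
exact: (measurable_sfunP (h n)).
Qed.


(** * Nonnegative real functions with finite expectation *)

Lemma condexp_ge0P (f : X -> \bar R) : measurable_fun setT f ->
  (forall x, 0 <= f x) -> (forall x, f x < +oo) ->
  is_condexp A mu f (condexp_ge0 A mu f).
Proof. by move=> mf f0 ffin; apply: xgetPex; exact: condexp_exists. Qed.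

Lemma condexp_ge0_le (f g : X -> \bar R) :
  measurable_fun setT f -> (forall x, 0 <= f x) ->
  measurable_fun setT g -> (forall x, g x < +oo) ->
  (forall x, f x <= g x) ->
  \forall x \ae mu, condexp_ge0 A mu f x <= condexp_ge0 A mu g x.
Proof.
move=> mf f0 mg gfin fg.
have g0 x : 0 <= g x by exact: le_trans (fg x).
have ffin x : f x < +oo by exact: le_lt_trans (gfin x).
have [mEf Ef0 Ef] := condexp_ge0P mf f0 ffin.
have [mEg Eg0 Eg] := condexp_ge0P mg g0 gfin.
apply: (condexp_le mEf Ef0 mEg Eg0) => B AB; rewrite (Ef _ AB) (Eg _ AB).
have mB := sub_measurable_set AB.
by apply: ge0_le_integral => //; exact: measurable_funTS.
Qed.

(** Requiring [g] to be real-valued expresses that the expectation of [f] is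
    finite a.e., up to the choice of a version. *)
Definition ge0_condexp (f g : X -> R) :=
  [/\ measurable_fun setT f, forall x, (0 <= f x)%R &
      is_condexp A mu (EFin \o f) (EFin \o g)].

Lemma ge0_condexp_measurable f g : ge0_condexp f g -> g \is-A-measurable.
Proof. by case=> _ _ [/measurable_EFinP]. Qed.

Lemma ge0_condexp_ge0 f g : ge0_condexp f g -> forall x, (0 <= g x)%R.
Proof. by case=> _ _ [_ g0 _] x; rewrite -lee_fin; exact: g0. Qed.

Lemma ge0_condexp0 : ge0_condexp (cst 0%R) (cst 0%R).
Proof.
split; [exact: measurable_cst|by move=> x; exact: lexx|].
split => [|x|//]; last exact: lexx.
by apply/measurable_EFinP; exact: measurable_cst.
Qed.

Lemma ge0_condexpD f1 f2 g1 g2 : ge0_condexp f1 g1 -> ge0_condexp f2 g2 ->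
  ge0_condexp (fun x => f1 x + f2 x)%R (fun x => g1 x + g2 x)%R.
Proof.
move=> E1 E2.
have mg1 := ge0_condexp_measurable E1; have mg2 := ge0_condexp_measurable E2.
have g10 := ge0_condexp_ge0 E1; have g20 := ge0_condexp_ge0 E2.
case: E1 => mf1 f10 [_ _ E1]; case: E2 => mf2 f20 [_ _ E2].
split; first exact: measurable_funD.
  by move=> x; rewrite addr_ge0.
split.
- by apply/measurable_EFinP; exact: measurable_funD.
- by move=> x; rewrite lee_fin addr_ge0.
move=> B AB; have mB := sub_measurable_set AB.
have add (h1 h2 : X -> R) : measurable_fun setT h1 -> (forall x, (0 <= h1 x)%R) ->
    measurable_fun setT h2 -> (forall x, (0 <= h2 x)%R) ->
    \int[mu]_(x in B) (h1 x + h2 x)%:E =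
    \int[mu]_(x in B) (h1 x)%:E + \int[mu]_(x in B) (h2 x)%:E.
  move=> mh1 h10 mh2 h20; under eq_integral do rewrite EFinD.
  rewrite ge0_integralD//; try by move=> x _; rewrite lee_fin.
  - by apply/measurable_EFinP; exact: measurable_funTS.
  - by apply/measurable_EFinP; exact: measurable_funTS.
rewrite [LHS]add//; [|exact: sub_measurable_fun..].
by rewrite [RHS]add//; congr (_ + _); [exact: E1|exact: E2].
Qed.

Lemma ge0_condexpM (a f g : X -> R) : a \is-A-measurable -> (forall x, (0 <= a x)%R) ->
  ge0_condexp f g -> ge0_condexp (fun x => a x * f x)%R (fun x => a x * g x)%R.
Proof.
move=> ma a0 E; have mg := ge0_condexp_measurable E.
have g0 := ge0_condexp_ge0 E; case: E => mf f0 [_ _ E].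
split; first by apply: measurable_funM => //; exact: sub_measurable_fun.
  by move=> x; rewrite mulr_ge0.
split; first by apply/measurable_EFinP; exact: measurable_funM.
  by move=> x; rewrite lee_fin mulr_ge0.
by apply: integral_mul_eq => //; exact: sub_measurable_fun.
Qed.

Lemma ge0_condexp_unique f1 f2 g1 g2 : ge0_condexp f1 g1 -> ge0_condexp f2 g2 ->
  (\forall x \ae mu, f1 x = f2 x) -> \forall x \ae mu, g1 x = g2 x.
Proof.
move=> E1 E2 f12.
have mg1 := ge0_condexp_measurable E1; have mg2 := ge0_condexp_measurable E2.
have g10 := ge0_condexp_ge0 E1; have g20 := ge0_condexp_ge0 E2.
case: E1 => mf1 f10 [_ _ E1]; case: E2 => mf2 f20 [_ _ E2].
have E12 B : A B -> \int[mu]_(x in B) (g1 x)%:E = \int[mu]_(x in B) (g2 x)%:E.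
  move=> AB; rewrite [LHS]E1// [RHS]E2//.
  apply: ge0_ae_eq_integral => //.
  - exact: sub_measurable_set.
  - by apply/measurable_EFinP; exact: measurable_funTS.
  - by apply/measurable_EFinP; exact: measurable_funTS.
  - by move=> x _; rewrite lee_fin.
  - by move=> x _; rewrite lee_fin.
  - by apply: filterS f12 => x /= ->.
have le12 : \forall x \ae mu, (g1 x)%:E <= (g2 x)%:E.
  apply: condexp_le; [exact/measurable_EFinP| |exact/measurable_EFinP| |].
  - by move=> x; rewrite lee_fin.
  - by move=> x; rewrite lee_fin.
  - by move=> B AB; rewrite E12.
have le21 : \forall x \ae mu, (g2 x)%:E <= (g1 x)%:E.
  apply: condexp_le; [exact/measurable_EFinP| |exact/measurable_EFinP| |].
  - by move=> x; rewrite lee_fin.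
  - by move=> x; rewrite lee_fin.
  - by move=> B AB; rewrite E12.
apply: filterS2 le12 le21 => x; rewrite !lee_fin => g12 g21.
by apply/eqP; rewrite eq_le g12 g21.
Qed.

Lemma ge0_condexp_fine (f : X -> R) : measurable_fun setT f -> (forall x, (0 <= f x)%R) ->
  (\forall x \ae mu, condexp_ge0 A mu (EFin \o f) x < +oo) ->
  ge0_condexp f (fine \o condexp_ge0 A mu (EFin \o f)).
Proof.
move=> mf f0 Ffin; split => //.
have mef : measurable_fun setT (EFin \o f) by exact/measurable_EFinP.
have [mE E0 E] := condexp_ge0P mef f0 (fun x => ltry (f x)).
have mE' : (EFin \o (fine \o condexp_ge0 A mu (EFin \o f))) \is-A-measurable.
  by apply/measurable_EFinP; exact: measurableT_comp.
split => //; first by move=> x; rewrite lee_fin fine_ge0.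
move=> B AB; rewrite -E//; have mB := sub_measurable_set AB.
apply: ge0_ae_eq_integral => //.
- exact/measurable_funTS/sub_measurable_fun.
- exact/measurable_funTS/sub_measurable_fun.
- by move=> x _; rewrite lee_fin fine_ge0.
- by apply: filterS Ffin => x Fx _; rewrite /= fineK// ge0_fin_numE.
Qed.

(** * Real and complex functions *)

(** [f1] and [f2] are arbitrary, not the positive and negative parts of [f]:
    this makes sums and products immediate, and [real_condexp_unique] shows that
    the choice does not affect [g] up to a null set. *)
Definition real_condexp (f g : X -> R) := exists f1 f2 g1 g2,
  [/\ ge0_condexp f1 g1, ge0_condexp f2 g2,
      (forall x, f x = f1 x - f2 x)%R & (forall x, g x = g1 x - g2 x)%R].

Lemma real_condexp_measurable f g : real_condexp f g -> g \is-A-measurable.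
Proof.
move=> [f1 [f2 [g1 [g2 [E1 E2 _ gE]]]]]; rewrite (funext gE).
by apply: measurable_funB;
  [exact: ge0_condexp_measurable E1|exact: ge0_condexp_measurable E2].
Qed.

Lemma real_condexp0 : real_condexp (cst 0%R) (cst 0%R).
Proof.
exists (cst 0%R), (cst 0%R), (cst 0%R), (cst 0%R).
by split => [| |x|x]; rewrite ?subr0//; exact: ge0_condexp0.
Qed.

Lemma real_condexpD f g f' g' : real_condexp f g -> real_condexp f' g' ->
  real_condexp (fun x => f x + f' x)%R (fun x => g x + g' x)%R.
Proof.
move=> [f1 [f2 [g1 [g2 [E1 E2 fE gE]]]]] [k1 [k2 [l1 [l2 [L1 L2 kE lE]]]]].
eexists; eexists; eexists; eexists; split;
  [exact: ge0_condexpD E1 L1|exact: ge0_condexpD E2 L2| |] => x /=.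
  by rewrite fE kE; ring.
by rewrite gE lE; ring.
Qed.

Lemma real_condexpN f g : real_condexp f g ->
  real_condexp (fun x => - f x)%R (fun x => - g x)%R.
Proof.
move=> [f1 [f2 [g1 [g2 [E1 E2 fE gE]]]]]; exists f2, f1, g2, g1.
by split => // x; rewrite ?fE ?gE opprB.
Qed.

(** With [a] and [f] both written as differences of nonnegative functions, the
    product expands into nonnegative terms grouped by sign. *)
Lemma real_condexpM (a f g : X -> R) : a \is-A-measurable -> real_condexp f g ->
  real_condexp (fun x => a x * f x)%R (fun x => a x * g x)%R.
Proof.
move=> ma [f1 [f2 [g1 [g2 [E1 E2 fE gE]]]]].
have mp : (a^\+)%R \is-A-measurable by exact: measurable_funrpos.
have mn : (a^\-)%R \is-A-measurable by exact: measurable_funrneg.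
have aE x : (a x = a^\+ x - a^\- x)%R by rewrite -[in LHS](funrposBneg a).
have M b f' g' := @ge0_condexpM b f' g'.
eexists; eexists; eexists; eexists; split;
  [apply: ge0_condexpD (M _ _ _ mp (funrpos_ge0 a) E1) (M _ _ _ mn (funrneg_ge0 a) E2)
  |apply: ge0_condexpD (M _ _ _ mp (funrpos_ge0 a) E2) (M _ _ _ mn (funrneg_ge0 a) E1)
  | |] => x /=.
  by rewrite fE aE; ring.
by rewrite gE aE; ring.
Qed.

(** If [f1 - f2 = f1' - f2'] then [f1 + f2' = f1' + f2], to which uniqueness for
    nonnegative functions applies. *)
Lemma real_condexp_unique f g f' g' : real_condexp f g -> real_condexp f' g' ->
  (\forall x \ae mu, f x = f' x) -> \forall x \ae mu, g x = g' x.
Proof.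
move=> [f1 [f2 [g1 [g2 [E1 E2 fE gE]]]]] [k1 [k2 [l1 [l2 [L1 L2 kE lE]]]]] ff'.
have := ge0_condexp_unique (ge0_condexpD E1 L2) (ge0_condexpD L1 E2).
move=> H; have {}H := H _.
have : \forall x \ae mu, (g1 x + l2 x = l1 x + g2 x)%R.
  apply: H; apply: filterS ff' => x; rewrite fE kE => /eqP.
  by rewrite subr_eq addrAC eq_sym subr_eq => /eqP.
apply: filterS => x; rewrite gE lE => /eqP gl; apply/eqP.
by rewrite subr_eq addrAC eq_sym subr_eq eq_sym.
Qed.

(** The positive and negative parts of [f] lie below [F], so their expectations
    are finite a.e. when that of [F] is. *)
Lemma condexp_realP (f : X -> R) (F : X -> \bar R) : measurable_fun setT f ->
  measurable_fun setT F -> (forall x, F x < +oo) ->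
  (forall x, `|f x|%:E <= F x) ->
  (\forall x \ae mu, condexp_ge0 A mu F x < +oo) ->
  real_condexp f (condexp_real A mu f).
Proof.
move=> mf mF Ffin fF EF.
have posE : ((EFin \o f)^\+)%E = EFin \o (f^\+)%R.
  by apply/funext => x; rewrite unlock /funrpos /= EFin_max.
have negE : ((EFin \o f)^\-)%E = EFin \o (f^\-)%R.
  by apply/funext => x; rewrite unlock /funrneg /= EFin_max.
have fE x : (f x = f^\+ x - f^\- x)%R by rewrite -[in LHS](funrposBneg f).
have fin (k : X -> R) : measurable_fun setT k -> (forall x, (0 <= k x)%R) ->
    (forall x, (k x <= `|f x|)%R) ->
    ge0_condexp k (fine \o condexp_ge0 A mu (EFin \o k)).
  move=> mk k0 kf; apply: ge0_condexp_fine => //.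
  have : \forall x \ae mu, condexp_ge0 A mu (EFin \o k) x <= condexp_ge0 A mu F x.
    apply: condexp_ge0_le => //; first exact/measurable_EFinP.
    by move=> x; apply: le_trans (fF x); rewrite lee_fin.
  by apply: filterS2 EF => x EFx /le_lt_trans; exact.
exists (f^\+)%R, (f^\-)%R, (fine \o condexp_ge0 A mu (EFin \o (f^\+)%R)),
  (fine \o condexp_ge0 A mu (EFin \o (f^\-)%R)); split => //.
- apply: fin => //; first exact: measurable_funrpos.
  by move=> x; rewrite /funrpos ge_max ler_norm normr_ge0.
- apply: fin => //; first exact: measurable_funrneg.
  by move=> x; rewrite /funrneg ge_max -normrN ler_norm normr_ge0.
- by move=> x; rewrite /condexp_real posE negE.
Qed.

Definition complex_condexp (f g : X -> R[i]) :=
  real_condexp (fun x => complex.Re (f x)) (fun x => complex.Re (g x)) /\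
  real_condexp (fun x => complex.Im (f x)) (fun x => complex.Im (g x)).

Lemma complex_condexp0 : complex_condexp (cst 0%R) (cst 0%R).
Proof. by split; exact: real_condexp0. Qed.

(** That [a] is a conditional expectation, of some [b], is a way to say that its
    real and imaginary parts are A-measurable. *)
Lemma complex_condexpM (a b f g : X -> R[i]) :
  complex_condexp b a -> complex_condexp f g ->
  complex_condexp (fun x => a x * f x)%R (fun x => a x * g x)%R.
Proof.
move=> [/real_condexp_measurable mr /real_condexp_measurable mi] [Er Ei].
have ReM (z t : R[i]) : complex.Re (z * t)%R =
    (complex.Re z * complex.Re t + - (complex.Im z * complex.Im t))%R.
  by case: z; case: t.
have ImM (z t : R[i]) : complex.Im (z * t)%R =
    (complex.Re z * complex.Im t + complex.Im z * complex.Re t)%R.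
  by case: z; case: t.
split.
- under eq_fun do rewrite ReM; under [X in real_condexp _ X]eq_fun do rewrite ReM.
  by apply: real_condexpD; [|apply: real_condexpN]; exact: real_condexpM.
- under eq_fun do rewrite ImM; under [X in real_condexp _ X]eq_fun do rewrite ImM.
  by apply: real_condexpD; exact: real_condexpM.
Qed.

Lemma complex_condexp_unique (f g f' g' : X -> R[i]) :
  complex_condexp f g -> complex_condexp f' g' ->
  (\forall x \ae mu, f x = f' x) -> \forall x \ae mu, g x = g' x.
Proof.
move=> [Er Ei] [Er' Ei'] ff'.
have gr : \forall x \ae mu, complex.Re (g x) = complex.Re (g' x).
  by apply: real_condexp_unique Er Er' _; apply: filterS ff' => x ->.
have gi : \forall x \ae mu, complex.Im (g x) = complex.Im (g' x).
  by apply: real_condexp_unique Ei Ei' _; apply: filterS ff' => x ->.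
apply: filterS2 gr gi => x /=.
by case: (g x) (g' x) => [a b] [c e] /= -> ->.
Qed.

Lemma conditionable_condexp (f : X -> R[i]) : conditionable A mu f ->
  complex_condexp f (condexp A mu f).
Proof.
move=> [[mr mi] Ef].
have normE (z : R[i]) :
    Normc.normc z = Num.sqrt (complex.Re z ^+ 2 + complex.Im z ^+ 2)%R.
  by case: z.
have mabs : measurable_fun setT (cabs f).
  apply/measurable_EFinP; under eq_fun do rewrite normE.
  apply: (measurableT_comp (continuous_measurable_fun (@sqrt_continuous R))).
  by apply: measurable_funD; exact: measurable_funX.
split; apply: (condexp_realP _ mabs) => // x; rewrite ?ltry// lee_fin normE -sqrtr_sqr.
  by rewrite ler_wsqrtr// lerDl sqr_ge0.
by rewrite ler_wsqrtr// lerDr sqr_ge0.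
Qed.

(** * The null spaces of the weighted operator *)

Lemma wce_ae0 (w u f : X -> R[i]) : conditionable A mu (fun x => u x * f x)%R ->
  (\forall x \ae mu, f x = 0%R) -> \forall x \ae mu, wce A mu w u f x = 0%R.
Proof.
move=> /conditionable_condexp Ef f0.
have uf0 : \forall x \ae mu, (u x * f x)%R = cst 0%R x.
  by apply: filterS f0 => x ->; rewrite mulr0.
apply: filterS (complex_condexp_unique Ef complex_condexp0 uf0) => x.
by rewrite /wce => ->; rewrite mulr0.
Qed.

(** The identity [h * h = g * k] a.e.: both sides are conditional expectations of
    the same function [u w g h]. *)
Lemma wce_cube_ae0 (w u f : X -> R[i]) (T := wce A mu w u) :
  conditionable A mu (fun x => u x * f x)%R ->
  conditionable A mu (fun x => u x * T f x)%R ->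
  conditionable A mu (fun x => u x * T (T f) x)%R ->
  (\forall x \ae mu, T (T (T f)) x = 0%R) -> \forall x \ae mu, T (T f) x = 0%R.
Proof.
move=> /conditionable_condexp Eg /conditionable_condexp Eh.
move=> /conditionable_condexp Ek T3.
set g := condexp A mu (fun x => u x * f x)%R in Eg.
set h := condexp A mu (fun x => u x * T f x)%R in Eh.
set k := condexp A mu (fun x => u x * T (T f) x)%R in Ek.
have T1E x : T f x = (w x * g x)%R by [].
have T2E x : T (T f) x = (w x * h x)%R by [].
have T3E x : T (T (T f)) x = (w x * k x)%R by [].
have hhgk : \forall x \ae mu, (h x * h x = g x * k x)%R.
  apply: complex_condexp_unique (complex_condexpM Eh Eh) (complex_condexpM Eg Ek) _.
  by apply: aeW => x; rewrite T1E T2E; ring.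
apply: filterS2 T3 hhgk => x.
rewrite T3E T2E; move=> /eqP; rewrite mulf_eq0.
move=> /orP[/eqP ->|/eqP ->]; first by rewrite mul0r.
by rewrite mulr0 => /eqP; rewrite mulf_eq0 orbb => /eqP ->; rewrite mulr0.
Qed.

End sub_sigma_algebra.

Theorem theorem2p3 (R : realType) (d : measure_display) (X : measurableType d)
    (mu : {measure set X -> \bar R}) (A : set (set X)) (p : \bar R)
    (w u : X -> R[i])
    (mu_complete : measure_is_complete mu)
    (mu_sigma_finite : sigma_finite [set: X] mu)
    (A_sub : sub_sigma_finite A mu)
    (p_ge1 : (1 <= p)%E)
    (w_meas : cmeasurable w)
    (u_meas : cmeasurable u)
    (uf_conditionable : forall f : X -> R[i], Lp mu p f ->
       conditionable A mu (fun x => (u x * f x)%R))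
    (T_maps_Lp : forall f : X -> R[i], Lp mu p f -> Lp mu p (wce A mu w u f))
    (T_bounded : bounded_on_Lp mu p (wce A mu w u)) :
  (forall n : nat,
     null_space mu p (iter 2 (wce A mu w u)) =
     null_space mu p (iter (n + 2) (wce A mu w u))) /\
  (ascent mu p (wce A mu w u) <= 2%:E)%E.
Proof.
set T := wce A mu w u.
have Lk k f : Lp mu p f -> Lp mu p (iter k T f).
  by move=> Lf; elim: k => //= k; exact: T_maps_Lp.
have aeE (f : X -> R[i]) : (f = cst 0%R %[ae mu]) <-> \forall x \ae mu, f x = 0%R.
  by split; apply: filterS => x; [exact|move=> ->].
have step k : null_space mu p (iter k.+2 T) = null_space mu p (iter k.+3 T).
  apply/seteqP; split => f [Lf] /aeE Tf; split => //; apply/aeE.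
    by apply: (wce_ae0 A_sub) Tf; apply/uf_conditionable/(Lk k.+2).
  apply: (wce_cube_ae0 A_sub) Tf; apply: uf_conditionable.
  - exact: Lk.
  - exact: (Lk k.+1).
  - exact: (Lk k.+2).
(* Comparing iterates must not unfold the operator. *)
clearbody T; split.
  move=> n; rewrite addn2; elim: n => [|n IHn]; first exact: erefl.
  exact: etrans IHn (step n).
rewrite /ascent; case: pselect => [ex|[]]; last first.
  by exists 2%N; apply/asboolP; exact: step 0%N.
case: ex_minnP => m _ mmin; rewrite lee_fin (ler_nat _ m 2); apply: mmin.
by apply/asboolP; exact: step 0%N.
Qed.
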